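(* Flutter (as defined in the context) satisfies Integrity: in every execution, if a correct server triggers $\langle tob.\mathrm{Deliver}\mid\theta,m\rangle$ for a correct client $\theta$ and a message $m\in\mathcal M$, then $\theta$ triggered $\langle tob.\mathrm{Broadcast}\mid m\rangle$.
   Context: **Model.** $f\ge 0$ is an integer; $\Pi$ is a fixed, commonly known set of $n=5f+1$ servers, of which at most $f$ are faulty (Byzantine: may behave arbitrarily and collude); $\Theta$ is a set of clients (possibly overlapping with $\Pi$), any number of which may be faulty; $\mathcal M$ is the set of messages; $\mathbb T$ denotes times (real numbers). Correct processes follow the algorithm. Any two processes (including a process and itself) communicate via reliable, authenticated, FIFO links. Partial synchrony: message delays are bounded by an unknown constant $\Delta$, and the difference between real time and the local time of any process is bounded by an unknown constant $\Psi$. Local clocks are non-decreasing; $local\_time()$ reads the local clock. Event handlers execute atomically, and a process delivers only finitely many messages in finite time. Correct clients never broadcast the same message twice. **Representative Binary Consensus** (instance $con$): every correct server proposes one value of $\mathbb B=\{\mathtt{True},\mathtt{False}\}$ via $\langle con.\mathrm{Propose}\mid p\rangle$, and may trigger $\langle con.\mathrm{Decide}\mid d\rangle$. Integrity: no correct server decides more than once. Agreement: no two correct servers decide different values. Termination: if every correct server proposes, every correct server eventually decides. Representative Validity: a decided value was proposed by at least $f+1$ correct servers. **Order.** Fix total orders on $\Theta$ and $\mathcal M$; $\Theta\times\mathcal M\times\mathbb T$ is totally ordered by comparing first the time component, then the client, then the message. The initial value $(\bot,\bot,-\infty)$ is below every element. **Flutter, server algorithm.** There is one independent Representative Binary Consensus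 instance $con[(\theta,m,b)]$ for every $(\theta,m,b)\in\Theta\times\mathcal M\times\mathbb T$. Each server keeps sets $observed,proposed,candidates\subseteq\Theta\times\mathcal M\times\mathbb T$ and $delivered\subseteq\Theta\times\mathcal M$ (all initially empty), a map $remote\_times:\Pi\to\mathbb T\cup\{-\infty\}$ (initially constantly $-\infty$), a map $decisions$ from $\Theta\times\mathcal M\times\mathbb T$ to $\mathbb B$ (initially empty), and $last\_processed$ (initially $(\bot,\bot,-\infty)$). - $beat()$: send $[\mathtt{Time},local\_time()]$ to every server. - Upon delivering $[\mathtt{Time},t]$ from $\pi$: $remote\_times[\pi]=\max(remote\_times[\pi],t)$. - $lock\_time()$: return the maximum $t$ such that $|\{\pi: remote\_times[\pi]\ge t\}|\ge 4f+1$. - $spot(\theta,m,b)$: if $b>lock\_time()$, add $(\theta,m,b)$ to $candidates$. Then, if $(\theta,m,b)\notin observed$: send $[\mathtt{Observe},\theta,m,b]$ to every server, schedule $beat()$ for execution at local time $b$ (immediately if $b$ has already passed), and add $(\theta,m,b)$ to $observed$. - Upon delivering $[\mathtt{Observe},\theta,m,b]$ from a server: $spot(\theta,m,b)$. - Upon delivering $[\mathtt{Message},m,b]$ from a client $\theta$: $spot(\theta,m,b)$; then, if $(\theta,m,b)\notin proposed$: trigger $\langle con[(\theta,m,b)].\mathrm{Propose}\mid (b>local\_time())\rangle$ (the truth value of the inequality) and add $(\theta,m,b)$ to $proposed$. - Upon existence of $(\theta,m,b)\in observed\setminus proposed$ with $b\le local\_time()$: trigger $\langle con[(\theta,m,b)].\mathrm{Propose}\mid\mathtt{False}\rangle$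 and add $(\theta,m,b)$ to $proposed$. - Upon $\langle con[(\theta,m,b)].\mathrm{Decide}\mid v\rangle$: send $[\mathtt{Decision},m,b,v]$ to $\theta$ and set $decisions[(\theta,m,b)]=v$. - Whenever the minimum $(\theta,m,b)$ among the elements of $candidates$ that are $>last\_processed$ exists, is a key of $decisions$, and satisfies $b\le lock\_time()$: if $decisions[(\theta,m,b)]=\mathtt{True}$, call $order(\theta,m,b)$; then set $last\_processed=(\theta,m,b)$. - $order(\theta,m,b)$: if $(\theta,m)\notin delivered$, trigger $\langle tob.\mathrm{Deliver}\mid\theta,m\rangle$ and add $(\theta,m)$ to $delivered$. **Flutter, client algorithm.** Parameters: message-delay estimate $\tilde\Delta>0$ (otherwise arbitrary) and a constant margin $\epsilon>0$. Each client keeps maps $submissions$ from $\mathcal M$ to $\mathbb N\times\mathbb T$ and $decisions$ from $\mathcal M\times\mathbb T\times\Pi$ to $\mathbb B$ (initially empty). - $submit(m,r)$: let $b=local\_time()+2^r\tilde\Delta+\epsilon$; send $[\mathtt{Message},m,b]$ to every server; set $submissions[m]=(r,b)$. - Upon $\langle tob.\mathrm{Broadcast}\mid m\rangle$: $submit(m,0)$. - Upon delivering $[\mathtt{Decision},m,b,v]$ from server $\pi$: $decisions[(m,b,\pi)]=v$. - Upon existence of $m$ with $submissions[m]=(r,b)$ and $|\{\pi: decisions[(m,b,\pi)]=\mathtt{False}\}|\ge f+1$: $submit(m,r+1)$. *)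

(* Defs.v *)
From HB Require Import structures.
From mathcomp Require Import all_boot all_order all_algebra.
From mathcomp Require Import finmap boolp classical_sets reals constructive_ereal.
Set Implicit Arguments.
Unset Strict Implicit.
Unset Printing Implicit Defensive.
Import Order.TTheory GRing.Theory Num.Theory.
Local Open Scope classical_set_scope.
Local Open Scope ring_scope.

(* Servers and clients are possibly overlapping sets of processes.  The total
   order on clients is the restriction of a total order on all processes (every
   total order on the clients arises in this way). *)
Record system (R : realType) := System {
  max_faulty : nat;
  proc_disp : Order.disp_t;
  proc : orderType proc_disp;
  message_disp : Order.disp_t;
  message : orderType message_disp;
  servers : {fset proc};
  clients : {pred proc};
  faulty : {pred proc};
  delay_estimate : R;
  margin : R;
  card_servers : #|` servers| = (5 * max_faulty + 1)%N;
  card_faulty_servers :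
    (#|` [fset p in servers | p \in faulty]%fset| <= max_faulty)%N;
  delay_estimate_gt0 : 0 < delay_estimate;
  margin_gt0 : 0 < margin
}.
Arguments clients {R} s _ : rename.
Arguments faulty {R} s _ : rename.

Section Flutter.
Variables (R : realType) (S : system R).
Local Notation f := (max_faulty S).
Local Notation proc := (proc S).
Local Notation message := (message S).
Local Notation servers := (servers S).
Local Notation clients := (clients S).

Definition correct (p : proc) : Prop := p \notin faulty S.

Definition entry : Type := (proc * message * R)%type.

(* Time first, then client, then message. *)
Definition entry_key (x : entry) : (R *l (proc *l message))%type :=
  (x.2, (x.1.1, x.1.2)).

Definition entry_lt (x y : entry) : bool := (entry_key x < entry_key y)%O.

Definition entry_le (x y : entry) : bool := (entry_key x <= entry_key y)%O.

(* [None] stands for the initial value, which lies below every entry. *)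
Definition above (last : option entry) (x : entry) : bool :=
  if last is Some y then entry_lt y x else true.

Inductive payload :=
| Time of R
| Observe of entry
| Message of message & R
| Decision of message & R & bool.

(* [Beat x] executes the beat scheduled when [x] was first spotted, [Expire x]
   proposes [false] for the observed entry [x] whose time has passed,
   [Process x] handles the least unprocessed candidate, and [Resubmit m] reacts
   to f + 1 negative decisions.  [Idle] has no effect; it pads histories. *)
Inductive event :=
| Idle
| Recv of proc & payload
| Broadcast of message
| Decide of entry & bool
| Beat of entry
| Expire of entry
| Process of entry
| Resubmit of message.

Inductive output :=
| Propose of entry & bool
| Deliver of proc & message.

Record server_state := ServerState {
  observed : set entry;
  proposed : set entry;
  candidates : set entry;
  delivered : set (proc * message);
  remote_times : proc -> \bar R;
  decisions : entry -> option bool;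
  last_processed : option entry;
  pending_beats : set entry
}.

Record client_state := ClientState {
  submissions : message -> option (nat * R);
  client_decisions : message * R * proc -> option bool
}.

Record state := State {
  server_part : server_state;
  client_part : client_state
}.

Definition init_state : state := State
  (ServerState set0 set0 set0 set0 (fun _ => -oo%E) (fun _ => None) None set0)
  (ClientState (fun _ => None) (fun _ => None)).

Definition time_quorum (rt : proc -> \bar R) (t : \bar R) : bool :=
  (4 * f + 1 <= #|` [fset p in servers | (t <= rt p)%E]%fset|)%N.

(* The maximum exists (the quorum condition holds at -oo and there are finitely
   many servers), so the default value of [xget] plays no role.  The value +oo
   of [\bar R] never arises: [remote_times] holds -oo or a received time. *)
Definition lock_time (s : server_state) : \bar R :=
  xget -oo%E [set t | time_quorum (remote_times s) t /\
                forall u, time_quorum (remote_times s) u -> (u <= t)%E].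

Definition next_entry (s : server_state) (x : entry) : Prop :=
  let todo := [set y | candidates s y /\ above (last_processed s) y] in
  todo x /\ forall y, todo y -> entry_le x y.

(* The messages sent to each process, in sending order. *)
Definition sends : Type := proc -> seq payload.

Definition no_send : sends := fun _ => [::].

Definition send_to (p : proc) (a : payload) : sends :=
  fun q => if q == p then [:: a] else [::].

Definition send_servers (a : payload) : sends :=
  fun q => if q \in servers then [:: a] else [::].

Definition spot (x : entry) (s : server_state) : server_state * sends :=
  let fresh := x \notin observed s in
  ({| observed := x |` observed s;
      proposed := proposed s;
      candidates := if (lock_time s < x.2%:E)%E then x |` candidates s
                    else candidates s;
      delivered := delivered s;
      remote_times := remote_times s;
      decisions := decisions s;
      last_processed := last_processed s;
      pending_beats := if fresh then x |` pending_beats s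
                       else pending_beats s |},
   if fresh then send_servers (Observe x) else no_send).

Definition on_time (p : proc) (t : R) (s : server_state) : server_state :=
  {| observed := observed s;
     proposed := proposed s;
     candidates := candidates s;
     delivered := delivered s;
     remote_times :=
       [eta remote_times s with p |-> Order.max (remote_times s p) t%:E];
     decisions := decisions s;
     last_processed := last_processed s;
     pending_beats := pending_beats s |}.

Definition add_proposed (x : entry) (s : server_state) : server_state :=
  {| observed := observed s;
     proposed := x |` proposed s;
     candidates := candidates s;
     delivered := delivered s;
     remote_times := remote_times s;
     decisions := decisions s;
     last_processed := last_processed s;
     pending_beats := pending_beats s |}.

Definition on_message (lt : R) (x : entry) (s : server_state) :
    server_state * sends * set output :=
  let: (s1, o) := spot x s in
  if x \in proposed s1 then (s1, o, set0)
  else (add_proposed x s1, o, [set Propose x (lt < x.2)]).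

Definition on_beat (x : entry) (s : server_state) : server_state :=
  {| observed := observed s;
     proposed := proposed s;
     candidates := candidates s;
     delivered := delivered s;
     remote_times := remote_times s;
     decisions := decisions s;
     last_processed := last_processed s;
     pending_beats := pending_beats s `\ x |}.

Definition on_decide (x : entry) (v : bool) (s : server_state) : server_state :=
  {| observed := observed s;
     proposed := proposed s;
     candidates := candidates s;
     delivered := delivered s;
     remote_times := remote_times s;
     decisions := [eta decisions s with x |-> Some v];
     last_processed := last_processed s;
     pending_beats := pending_beats s |}.

Definition on_process (x : entry) (s : server_state) :
    server_state * set output :=
  let ordered := decisions s x == Some true in
  ({| observed := observed s;
      proposed := proposed s;
      candidates := candidates s;
      delivered := if ordered then x.1 |` delivered s else delivered s;
      remote_times := remote_times s;
      decisions := decisions s;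
      last_processed := Some x;
      pending_beats := pending_beats s |},
   if ordered && (x.1 \notin delivered s) then [set Deliver x.1.1 x.1.2]
   else set0).

Definition submit (lt : R) (m : message) (r : nat) (c : client_state) :
    client_state * sends :=
  let b := lt + 2 ^+ r * delay_estimate S + margin S in
  ({| submissions := [eta submissions c with m |-> Some (r, b)];
      client_decisions := client_decisions c |},
   send_servers (Message m b)).

Definition on_decision (p : proc) (m : message) (b : R) (v : bool)
    (c : client_state) : client_state :=
  {| submissions := submissions c;
     client_decisions := [eta client_decisions c with (m, b, p) |-> Some v] |}.

Definition refusals (c : client_state) (m : message) (b : R) : nat :=
  #|` [fset p in servers | client_decisions c (m, b, p) == Some false]%fset|.

(* Guard of the handler of an event at process [p] with local time [lt]. *)
Definition enabled (p : proc) (lt : R) (s : state) (e : event) : Prop :=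
  let sv := server_part s in
  match e with
  | Idle | Recv _ _ => True
  | Broadcast _ => p \in clients
  | Decide x _ => p \in servers /\ x.1.1 \in clients
  | Beat x => [/\ p \in servers, pending_beats sv x & x.2 <= lt]
  | Expire x =>
      [/\ p \in servers, observed sv x, ~ proposed sv x & x.2 <= lt]
  | Process x =>
      [/\ p \in servers, next_entry sv x, decisions sv x != None
        & (x.2%:E <= lock_time sv)%E]
  | Resubmit m =>
      p \in clients /\
      exists r b, submissions (client_part s) m = Some (r, b) /\
                  (f + 1 <= refusals (client_part s) m b)%N
  end.

Definition internal (e : event) : bool :=
  match e with
  | Beat _ | Expire _ | Process _ | Resubmit _ => true
  | _ => false
  end.

(* Atomic execution of a handler: next state, messages sent, outputs.
   Received messages that no handler expects (wrong role of the sender or of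
   the receiver, or an entry whose first component is not a client) are
   ignored.  The local clock is read once per execution of a handler. *)
Definition handle (p : proc) (lt : R) (s : state) (e : event) :
    state * sends * set output :=
  let sv := server_part s in
  let cl := client_part s in
  let ignore := (s, no_send, set0) in
  match e with
  | Idle => ignore
  | Recv q (Time t) =>
      if (p \in servers) && (q \in servers)
      then (State (on_time q t sv) cl, no_send, set0) else ignore
  | Recv q (Observe x) =>
      if [&& p \in servers, q \in servers & x.1.1 \in clients]
      then let: (sv1, o) := spot x sv in (State sv1 cl, o, set0) else ignore
  | Recv q (Message m b) =>
      if (p \in servers) && (q \in clients)
      then let: (sv1, o, out) := on_message lt (q, m, b) sv in
           (State sv1 cl, o, out)
      else ignore
  | Recv q (Decision m b v) =>
      if (p \in clients) && (q \in servers)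
      then (State sv (on_decision q m b v cl), no_send, set0) else ignore
  | Broadcast m =>
      let: (cl1, o) := submit lt m 0 cl in (State sv cl1, o, set0)
  | Decide x v =>
      (State (on_decide x v sv) cl,
       send_to x.1.1 (Decision x.1.2 x.2 v), set0)
  | Beat x => (State (on_beat x sv) cl, send_servers (Time lt), set0)
  | Expire x =>
      (State (add_proposed x sv) cl, no_send, [set Propose x false])
  | Process x =>
      let: (sv1, out) := on_process x sv in (State sv1 cl, no_send, out)
  | Resubmit m =>
      if submissions cl m is Some (r, _)
      then let: (cl1, o) := submit lt m r.+1 cl in (State sv cl1, o, set0)
      else ignore
  end.

(* Every process has an infinite sequence of steps (a finite one is padded with
   [Idle]); [state_at p i] is the state before step [i], and [clock p t] is the
   local time of [p] at real time [t]. *)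
Record execution := Execution {
  clock : proc -> R -> R;
  real_time : proc -> nat -> R;
  state_at : proc -> nat -> state;
  event_at : proc -> nat -> event;
  sent_at : proc -> nat -> sends;
  output_at : proc -> nat -> set output
}.

Section Runs.
Variable E : execution.

Definition local_time (p : proc) (i : nat) : R := clock E p (real_time E p i).

Definition enabled_at (p : proc) (i : nat) (e : event) : Prop :=
  enabled p (local_time p i) (state_at E p i) e.

Definition sent_log (p q : proc) (i : nat) : seq payload :=
  flatten [seq sent_at E p k q | k <- iota 0 i].

Definition recv_from (p : proc) (e : event) : seq payload :=
  if e is Recv p' a then if p' == p then [:: a] else [::] else [::].

Definition recv_log (p q : proc) (j : nat) : seq payload :=
  flatten [seq recv_from p (event_at E q k) | k <- iota 0 j].

(* In step [i], [p] sends [a] as its [k]-th message to [q]. *)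
Definition sends_nth (p q : proc) (k : nat) (a : payload) (i : nat) : Prop :=
  (size (sent_log p q i) <= k)%N /\ onth (sent_log p q i.+1) k = Some a.

(* In step [j], [q] delivers [a] as its [k]-th message from [p]. *)
Definition delivers_nth (p q : proc) (k : nat) (a : payload) (j : nat) : Prop :=
  size (recv_log p q j) = k /\ event_at E q j = Recv p a.

Inductive happens_before : proc * nat -> proc * nat -> Prop :=
| hb_local p i j : (i < j)%N -> happens_before (p, i) (p, j)
| hb_message p q k a i j : sends_nth p q k a i -> delivers_nth p q k a j ->
    happens_before (p, i) (q, j)
| hb_trans x y z :
    happens_before x y -> happens_before y z -> happens_before x z.

(* Excludes cycles through messages delivered without delay. *)
Definition causal : Prop := forall x, ~ happens_before x x.

(* The last clause says that finitely many steps occur in finite time. *)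
Definition timed : Prop :=
  forall p, {homo real_time E p : i j / (i <= j)%N >-> i <= j} /\
            forall t, exists i, t < real_time E p i.

Definition clocks_synchronized (Psi : R) : Prop :=
  (forall p, {homo clock E p : t u / t <= u}) /\
  (forall p t, `|clock E p t - t| <= Psi).

(* Reliable, authenticated, FIFO links with delay at most [Delta]: on every
   link the [k]-th delivered message is the [k]-th sent one. *)
Definition links (Delta : R) : Prop :=
  (forall p q k a j, delivers_nth p q k a j ->
     exists i, sends_nth p q k a i /\ real_time E p i <= real_time E q j) /\
  (forall p q k a i, sends_nth p q k a i ->
     exists j, delivers_nth p q k a j /\
               real_time E q j <= real_time E p i + Delta).

Definition follows_algorithm (p : proc) : Prop :=
  state_at E p 0 = init_state /\
  forall i, enabled_at p i (event_at E p i) /\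
            (state_at E p i.+1, sent_at E p i, output_at E p i) =
            handle p (local_time p i) (state_at E p i) (event_at E p i).

(* Internal handlers run eventually, not necessarily at the instant at which
   they become enabled. *)
Definition fair (p : proc) : Prop :=
  forall e i, internal e ->
    exists2 j, (i <= j)%N & event_at E p j = e \/ ~ enabled_at p j e.

Definition proposes (p : proc) (x : entry) (v : bool) (i : nat) : Prop :=
  output_at E p i (Propose x v).

Definition correct_server (p : proc) : Prop := p \in servers /\ correct p.

Definition con_integrity (x : entry) : Prop :=
  forall p i j v w, correct_server p ->
    event_at E p i = Decide x v -> event_at E p j = Decide x w -> i = j.

Definition con_agreement (x : entry) : Prop :=
  forall p q i j v w, correct_server p -> correct_server q ->
    event_at E p i = Decide x v -> event_at E q j = Decide x w -> v = w.

Definition con_termination (x : entry) : Prop :=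
  (forall p, correct_server p -> exists v i, proposes p x v i) ->
  forall p, correct_server p -> exists v i, event_at E p i = Decide x v.

(* The proposals occur no later than the decision. *)
Definition con_representative_validity (x : entry) : Prop :=
  forall p i v, correct_server p -> event_at E p i = Decide x v ->
    exists A : {fset proc},
      (f + 1 <= #|` A|)%N /\
      forall q, q \in A -> correct_server q /\
        exists2 j, proposes q x v j & real_time E q j <= real_time E p i.

Definition representative_consensus (x : entry) : Prop :=
  [/\ con_integrity x, con_agreement x, con_termination x
    & con_representative_validity x].

Definition no_rebroadcast (p : proc) : Prop :=
  forall i j m, event_at E p i = Broadcast m -> event_at E p j = Broadcast m ->
    i = j.

Record flutter_execution : Prop := FlutterExecution {
  fe_timed : timed;
  fe_clocks : exists Psi, clocks_synchronized Psi;
  fe_links : exists Delta, links Delta;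
  fe_causal : causal;
  fe_algorithm : forall p, correct p -> follows_algorithm p;
  fe_fair : forall p, correct p -> fair p;
  fe_consensus : forall x, x.1.1 \in clients -> representative_consensus x;
  fe_no_rebroadcast : forall p, p \in clients -> correct p -> no_rebroadcast p
}.

Definition tob_broadcasts (p : proc) (m : message) (i : nat) : Prop :=
  event_at E p i = Broadcast m.

Definition tob_delivers (p q : proc) (m : message) (i : nat) : Prop :=
  output_at E p i (Deliver q m).

End Runs.
End Flutter.

(* Main.v *)
Require Import Defs.
From mathcomp Require Import all_boot all_order all_algebra.
From mathcomp Require Import finmap boolp classical_sets reals constructive_ereal.
Set Implicit Arguments.
Unset Strict Implicit.
Unset Printing Implicit Defensive.

Local Open Scope ring_scope.

(* A delivery of (theta, m) needs a positive decision on some (theta, m, b), and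
   by Representative Validity some correct server proposed [true] for it.  Only
   the handler of a message from theta proposes [true], so the authenticated
   link makes theta send that message, in an initial submission or in a
   resubmission; the latter needs a recorded submission, whose first occurrence
   is a broadcast. *)

Lemma handle_deliver (R : realType) (S : system R) (p q : proc S) (lt : R)
    (s : state S) (e : event S) (m : message S) :
  (handle p lt s e).2 (Deliver q m) ->
  exists b, e = Process (q, m, b) /\
            decisions (server_part s) (q, m, b) = Some true.
Proof.
case: e => [|q' [t|x|m' b|m' b v]|m'|x v|x|x|[[q' m'] b]|m'] //=.
- by case: ifP.
- by case: ifP.
- case: ifP => // _; rewrite /on_message /=.
  by case: ifP.
- by case: ifP.
- case: ifP => //= /andP[/eqP dec _] [-> ->].
  by exists b.
- by case: submissions => // -[].
Qed.

(** The only other source of proposals is [Expire], which always proposes [false]. *)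
Lemma handle_propose_true (R : realType) (S : system R) (p : proc S) (lt : R)
    (s : state S) (e : event S) (x : entry S) :
  (handle p lt s e).2 (Propose x true) ->
  e = Recv x.1.1 (Message x.1.2 x.2).
Proof.
case: e => [|q' [t|y|m' b|m' b v]|m'|y v|y|y|y|m'] //=.
- by case: ifP.
- by case: ifP.
- case: ifP => // _; rewrite /on_message /=.
  by case: ifP => //= _ [->].
- by case: ifP.
- by case: ifP.
- by case: submissions => // -[].
Qed.

Lemma onth_send_servers (R : realType) (S : system R) (q : proc S) (k : nat)
    (a c : payload S) :
  onth (send_servers c q) k = Some a -> a = c.
Proof.
rewrite /send_servers; case: ifP => _; case: k => [|[|k]] //=.
by case.
Qed.

(** Besides [Broadcast], only [Resubmit] emits a [Message], and it does so only after reading an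
    existing record for [m]. *)
Lemma handle_send_message (R : realType) (S : system R) (p q : proc S) (lt : R)
    (s : state S) (e : event S) (m : message S) (b : R) (k : nat) :
  onth ((handle p lt s e).1.2 q) k = Some (Message m b) ->
  e = Broadcast m \/ submissions (client_part s) m <> None.
Proof.
(* This disposes of every branch below that sends nothing to [q]. *)
have no_sendP : onth (@no_send R S q) k <> Some (Message m b) by case: k.
case: e => [|q' [t|y|m' b'|m' b' v]|m'|y v|y|y|y|m'] //=.
- by case: ifP.
- case: ifP => //= _; case: ifP => // _.
  by move/onth_send_servers.
- case: ifP => // _; rewrite /on_message /=.
  by case: ifP => /= _; case: ifP => // _ /onth_send_servers.
- by case: ifP.
- by case/onth_send_servers => ->; left.
- rewrite /send_to; case: ifP => // _.
  by case: k {no_sendP} => [|[|k]].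
- by move/onth_send_servers.
- case sub: submissions => [[r b']|] //=.
  by case/onth_send_servers => -> _; right; rewrite sub.
Qed.

Lemma handle_decisions (R : realType) (S : system R) (p : proc S) (lt : R)
    (s : state S) (e : event S) (x : entry S) (v : bool) :
  decisions (server_part (handle p lt s e).1.1) x = Some v ->
  decisions (server_part s) x = Some v \/ e = Decide x v.
Proof.
case: e => [|q' [t|y|m' b|m' b w]|m'|y w|y|y|y|m'] /=; try by left.
- by case: ifP; left.
- by case: ifP; left.
- case: ifP => _; last by left.
  by rewrite /on_message /=; case: ifP; left.
- by case: ifP; left.
- by case: eqP => [-> [->]|_]; [right|left].
- by case: submissions => [[]|]; left.
Qed.

(** [Resubmit] overwrites only a record that is already there, so it never creates the first one. *)
Lemma handle_submissions (R : realType) (S : system R) (p : proc S) (lt : R)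
    (s : state S) (e : event S) (m : message S) :
  submissions (client_part (handle p lt s e).1.1) m <> None ->
  submissions (client_part s) m <> None \/ e = Broadcast m.
Proof.
case: e => [|q' [t|y|m' b|m' b w]|m'|y w|y|y|y|m'] /=; try by left.
- by case: ifP; left.
- by case: ifP; left.
- case: ifP => _; last by left.
  by rewrite /on_message /=; case: ifP; left.
- by case: ifP; left.
- by case: eqP => [->|_]; [right|left].
- case sub: (submissions _ m') => [[r b]|] /=; last by left.
  by case: eqP => [->|_]; left; rewrite ?sub.
Qed.

Lemma decided_before (R : realType) (S : system R) (E : execution S)
    (p : proc S) (x : entry S) (v : bool) (i : nat) :
  follows_algorithm E p ->
  decisions (server_part (state_at E p i)) x = Some v ->
  exists2 k, (k < i)%N & event_at E p k = Decide x v.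
Proof.
case=> init step; elim: i => [|i IHi]; first by rewrite init.
have [_ eq_step] := step i.
(* Seen as a component of the step triple, the new state can be rewritten with [eq_step]. *)
have -> : state_at E p i.+1 = (state_at E p i.+1, sent_at E p i,
                               output_at E p i).1.1 by [].
rewrite eq_step => /handle_decisions[/IHi[k lt_ki ev]|ev].
  by exists k => //; apply: ltnW.
by exists i.
Qed.

Lemma broadcast_before (R : realType) (S : system R) (E : execution S)
    (p : proc S) (m : message S) (i : nat) :
  follows_algorithm E p ->
  submissions (client_part (state_at E p i)) m <> None ->
  exists2 k, (k < i)%N & event_at E p k = Broadcast m.
Proof.
case=> init step; elim: i => [|i IHi]; first by rewrite init.
have [_ eq_step] := step i.
have -> : state_at E p i.+1 = (state_at E p i.+1, sent_at E p i,
                               output_at E p i).1.1 by [].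
rewrite eq_step => /handle_submissions[/IHi[k lt_ki ev]|ev].
  by exists k => //; apply: ltnW.
by exists i.
Qed.

Lemma output_handle (R : realType) (S : system R) (E : execution S)
    (p : proc S) (i : nat) :
  follows_algorithm E p ->
  output_at E p i =
    (handle p (local_time E p i) (state_at E p i) (event_at E p i)).2.
Proof. by case=> _ step; have [_ <-] := step i. Qed.

Lemma sends_message_broadcast (R : realType) (S : system R) (E : execution S)
    (p q : proc S) (m : message S) (b : R) (k i : nat) :
  follows_algorithm E p ->
  sends_nth E p q k (Message m b) i ->
  exists2 j, (j <= i)%N & event_at E p j = Broadcast m.
Proof.
(* The log through step [i] is the log before it followed by the sends of step [i]. By [le_k]
   position [k] falls in the second part, so the message is emitted by the handler run at step
   [i]. *)
move=> alg [le_k]; rewrite /sent_log -addn1 iotaD add0n map_cat flatten_cat.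
rewrite -/(sent_log E p q i) /= cats0 onth_cat ltnNge le_k /=.
have [_ step] := alg; have [_ eq_step] := step i.
have -> : sent_at E p i = (state_at E p i.+1, sent_at E p i,
                           output_at E p i).1.2 by [].
rewrite eq_step => /handle_send_message[ev|]; first by exists i.
by case/(broadcast_before alg) => j lt_ji ev; exists j => //; apply: ltnW.
Qed.

Theorem theorem7 (R : realType) (S : system R) (E : execution S)
    (hE : flutter_execution E)
    (pi theta : proc S) (m : message S) (i : nat)
    (pi_server : pi \in servers S) (pi_correct : correct pi)
    (theta_client : theta \in clients S) (theta_correct : correct theta)
    (hdeliver : tob_delivers E pi theta m i) :
  exists2 j, tob_broadcasts E theta m j
           & real_time E theta j <= real_time E pi i.
Proof.
have alg p := @fe_algorithm _ _ _ hE p.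
have mono p := (fe_timed hE p).1.
have [Delta [links_sent _]] := fe_links hE.
move: hdeliver; rewrite /tob_delivers output_handle; last exact: alg.
case/handle_deliver => b [_ /(decided_before (alg _ pi_correct))[k lt_ki decide]].
have [_ _ _ validity] := @fe_consensus _ _ _ hE (theta, m, b) theta_client.
have [A [cardA propA]] := validity _ _ _ (conj pi_server pi_correct) decide.
(* Since [f + 1] is positive, [A] contains a correct server; one proposer of [true] suffices. *)
have [|q qA] := fset0Pn A _.
  by rewrite -cardfs_gt0; apply: leq_trans cardA; rewrite addn1.
have [[_ q_correct] [j]] := propA q qA.
rewrite /proposes output_handle; last exact: alg.
move/handle_propose_true => recv le_jk.
(* With [erefl] the link index becomes the number of messages that [q] delivered from [theta] before
   step [j]. *)
have [l [sent le_lj]] := links_sent _ _ _ _ _ (conj erefl recv).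
have [n le_nl bcast] := sends_message_broadcast (alg _ theta_correct) sent.
exists n => //.
(* The real times increase along broadcast [n], sending [l], receipt and proposal [j], decision [k],
   delivery [i]. *)
apply: Order.POrderTheory.le_trans (mono _ _ _ (ltnW lt_ki)).
apply: Order.POrderTheory.le_trans le_jk.
by apply: Order.POrderTheory.le_trans le_lj; apply: mono.
Qed.
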